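(* Let $\mathcal{X}$ be a set equipped with a sigma-field $\mathcal{A}$. Let $\psi:[0,1]\to\mathbb{R}^+$ be a convex, increasing function with $\psi(0)=0=\psi'(0)$, and let $\gamma$ be a decreasing function on $[0,1]$ with $\gamma(0)=\infty$ and $\gamma(r)$ finite for $0<r\le 1$. Define $G(\eta,\theta):=\psi(1-\theta)+\theta\eta$ and $G(\eta):=\inf_{0\le\theta\le1}G(\eta,\theta)$ for $\eta\in\mathbb{R}^+$, with $G(\infty):=\psi(1)$. Suppose (i) $r\mapsto \exp\bigl(G(\gamma(r)-\gamma(r_0))\bigr)$ is concave on $[0,r_0]$, for each $r_0$ with $0<r_0\le 1$; (ii) $(1-p)e^{\psi(1)}+p\le e^{\gamma(p)}$ for $0\le p\le 1$. Then $$ \mathbb{E}\exp\bigl(F_\psi(X,A)\bigr)\le \exp\bigl(\gamma(\mathbb{P}\{X\in A\})\bigr) $$ for every $n\ge1$, every $A\in\mathcal{A}^n$ and every random element $X=(X_1,\dots,X_n)$ of $\mathcal{X}^n$ with independent components, where $$ F_\psi(x,A):=\inf_{\nu\in\mathcal{P}(A)}\ \sum_{i\le n}\psi\bigl(\nu\{y\in A: y_i\ne x_i\}\bigr). $$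
   Context: $\mathcal{A}^n$ denotes the product sigma-field on $\mathcal{X}^n$. For $A\in\mathcal{A}^n$, $\mathcal{P}(A)$ is the set of all Borel probability measures $\nu$ on $\mathcal{X}^n$ for which $\nu(A)=1$ (the only sigma-field specified on $\mathcal{X}^n$ is $\mathcal{A}^n$). For $x=(x_1,\dots,x_n)\in\mathcal{X}^n$, $\nu\{y\in A:y_i\ne x_i\}$ is the $\nu$-measure of the set of points $y=(y_1,\dots,y_n)$ of $A$ whose $i$th coordinate differs from $x_i$. $\mathbb{R}^+=[0,\infty)$, and $\psi'(0)$ is the right-hand derivative at $0$. $\mathbb{E}$ denotes expectation. Since $\gamma(0)=\infty$, one reads $\gamma(0)-\gamma(r_0)=\infty$, so at $r=0$ the function in (i) takes the value $e^{G(\infty)}=e^{\psi(1)}$; also $e^\infty=\infty$.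
   Formalization: For a general sigma-field the set {y in A: y_i≠x_i} need not be measurable; ν of it is read as its inner measure (equal to ν when measurable), and the expectation of exp F_ψ(X,A), if not measurable, as the supremum of integrals of simple functions below it. *)

(* Defs.v *)
From HB Require Import structures.
From mathcomp Require Import all_boot all_order all_algebra.
From mathcomp Require Import all_classical all_reals all_analysis.

Set Implicit Arguments.
Unset Strict Implicit.
Unset Printing Implicit Defensive.

Import Order.TTheory GRing.Theory Num.Theory.
Import numFieldNormedType.Exports.

Local Open Scope classical_set_scope.
Local Open Scope ring_scope.

Definition concave_function (R : realType) (D : set R) (f : R -> R) : Prop :=
  convex_function (D : set R^o) (fun x : R^o => (- f x : R^o)).

(* Product rule over every finite subfamily of the coordinates. *)
Definition independent_components (d d' : measure_display)
    (Omega : measurableType d) (T : measurableType d') (R : realType)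
    (P : probability Omega R) (n : nat) (X : Omega -> n.-tuple T) : Prop :=
  forall (J : {set 'I_n}) (B : 'I_n -> set T),
    (forall i, i \in J -> measurable (B i)) ->
    P (\bigcap_(i in [set` J]) [set w | B i (tnth (X w) i)]) =
    (\prod_(i in J) P [set w | B i (tnth (X w) i)])%E.

(* [inner_measure nu S] is [nu S] as soon as [S] is measurable (see
   [inner_measureE]).  The set [S = {y in A | y_i <> x_i}] used below is
   measurable when the singletons of the coordinate space are, but not for an
   arbitrary sigma-field; the value of [nu] itself outside the sigma-field is an
   arbitrary nonnegative number in the library. *)
Definition inner_measure (d : measure_display) (T : measurableType d)
    (R : realType) (nu : probability T R) (S : set T) : \bar R :=
  ereal_sup [set nu B | B in [set B | measurable B /\ B `<=` S]].

Lemma inner_measureE (d : measure_display) (T : measurableType d)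
    (R : realType) (nu : probability T R) (S : set T) :
  measurable S -> inner_measure nu S = nu S.
Proof.
move=> mS; apply/eqP; rewrite eq_le; apply/andP; split.
- apply: ge_ereal_sup => _ [B [mB BS] <-].
  by apply: le_measure BS; rewrite inE.
- by apply: ereal_sup_ubound; exists S => //; split.
Qed.

Definition prob_on (d : measure_display) (T : measurableType d) (R : realType)
    (A : set T) : set (probability T R) := [set nu | nu A = 1%E].

(* Extended-real valued: the infimum is [+oo] when [A] is empty. *)
Definition Fpsi (d : measure_display) (T : measurableType d) (R : realType)
    (psi : R -> R) (n : nat) (x : n.-tuple T) (A : set (n.-tuple T)) : \bar R :=
  ereal_inf [set (\sum_(i < n) psi (fine (inner_measure nu
                    [set y | A y /\ tnth y i <> tnth x i])))%:E
            | nu in @prob_on _ (n.-tuple T) R A].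

Definition G2 (R : realType) (psi : R -> R) (eta theta : R) : R :=
  psi (1 - theta) + theta * eta.

(* Only arguments in [0, +oo] matter; the value at [-oo] is irrelevant. *)
Definition G1 (R : realType) (psi : R -> R) (eta : \bar R) : R :=
  match eta with
  | r%:E => inf [set G2 psi r theta | theta in `[0, 1]]
  | +oo%E => psi 1
  | -oo%E => 0
  end.

(* Main.v *)
Require Import Defs.
From HB Require Import structures.
From mathcomp Require Import all_boot all_order all_algebra.
From mathcomp Require Import all_classical all_reals all_analysis.
From mathcomp Require Import measurable_realfun.
From mathcomp Require Import ring lra.

(* Induction on the number of coordinates. Mixing, with weights t and 1 - t, a
   measure on the section A_u with a measure on another section A_m gives
     F(u :: y, A) <= psi(1 - t) + t F(y, A_u) + (1 - t) F(y, A_m).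
   Exponentiating, integrating in y (weighted AM-GM in place of Hoelder's
   inequality) and optimising over t and m bounds the integral over y by
   exp(gamma(s)) exp(G(gamma(P(A_u)) - gamma(s))) with s close to the largest
   probability of a section; Jensen's inequality for this concave function of
   P(A_u), followed by G(eta) <= eta, gives exp(gamma(P(A))).

   The function F(., A) need not be measurable and the sigma-field of Omega can
   be larger than the one generated by X, so that an upper bound for the upper
   integral is needed. The induction therefore produces a measurable majorant of
   exp(F(., A_z)), jointly measurable in y and in a parameter z. To preserve
   measurability, m is not chosen but averaged over the sections of probability
   at least s, and the infimum is taken over countably many coefficients. *)

Set Implicit Arguments.
Unset Strict Implicit.
Unset Printing Implicit Defensive.

Import Order.TTheory GRing.Theory Num.Theory.
Import numFieldNormedType.Exports.

Local Open Scope classical_set_scope.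
Local Open Scope ring_scope.

(** * Convexity on intervals, supporting lines and weighted AM-GM *)

Lemma convex_function_itvP (R : realType) (a b : R) (f : R -> R) :
  convex_function (`[a, b] : set R^o) (f : R^o -> R^o) ->
  forall t x y, 0 <= t <= 1 -> a <= x <= b -> a <= y <= b ->
    f (t * x + (1 - t) * y) <= t * f x + (1 - t) * f y.
Proof.
move=> cf t x y /andP[t0 t1] xab yab.
have := cf (Itv01 t0 t1) x y; rewrite !inE /= !in_itv /= => /(_ xab yab).
by rewrite !convRE.
Qed.

Lemma concave_function_itvP (R : realType) (a b : R) (f : R -> R) :
  concave_function `[a, b] f ->
  forall t x y, 0 <= t <= 1 -> a <= x <= b -> a <= y <= b ->
    t * f x + (1 - t) * f y <= f (t * x + (1 - t) * y).
Proof.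
move=> /convex_function_itvP cf t x y t01 xab yab.
by have := cf t x y t01 xab yab; rewrite !mulrN -opprD lerN2.
Qed.

(** By concavity every chord slope to the right of [p] is at most every chord slope to its left; the
    supremum of the right slopes lies between the two families. As [p] is interior, neither family
    is empty. *)
Lemma concave_supporting_line (R : realType) (a b p : R) (f : R -> R) :
  a < p < b -> concave_function `[a, b] f ->
  exists c, forall s, a <= s <= b -> f s <= f p + c * (s - p).
Proof.
move=> /andP[ap pb] /concave_function_itvP cf.
pose S := [set (f s - f p) / (s - p) | s in `]p, b]].
have chord u s : a <= u < p -> p < s <= b ->
    (f s - f p) / (s - p) <= (f p - f u) / (p - u).
  move=> /andP[au up] /andP[ps sb].
  have su : 0 < s - u by lra.
  have := cf ((s - p) / (s - u)) u s _ _ _.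
  have -> : (s - p) / (s - u) * u + (1 - (s - p) / (s - u)) * s = p.
    by field; rewrite gt_eqF.
  have t01 : 0 <= (s - p) / (s - u) <= 1.
    by rewrite divr_ge0 ?ler_pdivrMr ?mul1r//; lra.
  have uab : a <= u <= b by lra.
  have sab : a <= s <= b by lra.
  move=> /(_ t01 uab sab).
  have -> : (s - p) / (s - u) * f u + (1 - (s - p) / (s - u)) * f s =
    ((s - p) * f u + (p - u) * f s) / (s - u) by field; rewrite gt_eqF.
  rewrite ler_pdivrMr// => h.
  rewrite ler_pdivrMr; last lra.
  by rewrite mulrAC ler_pdivlMr; [nra|lra].
have aS : S ((f b - f p) / (b - p)) by exists b => //=; rewrite in_itv /= pb lexx.
have ubS u : a <= u < p -> ubound S ((f p - f u) / (p - u)).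
  by move=> au _ [s + <-] => /=; rewrite in_itv /= => ps; exact: chord.
have hS : has_sup S.
  split; first by exists ((f b - f p) / (b - p)).
  by exists ((f p - f a) / (p - a)); apply: ubS; lra.
exists (sup S) => s /andP[as0 sb].
case: (ltgtP s p) => [sp|ps|sp]; last by rewrite sp subrr mulr0 addr0.
- have := ge_sup hS.1 (ubS s _); rewrite as0 sp => /(_ isT).
  by rewrite ler_pdivlMr ?subr_gt0//; nra.
- have : (f s - f p) / (s - p) <= sup S.
    by apply: ub_le_sup; [exact: hS.2|exists s => //=; rewrite in_itv /= ps sb].
  by rewrite ler_pdivrMr ?subr_gt0//; nra.
Qed.

Lemma expR_convex_shift (R : realType) (t x y : R) : 0 <= t <= 1 ->
  expR (t * x + (1 - t) * y) <= t * expR x + (1 - t) * expR y.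
Proof.
move=> /andP[t0 t1]; have := convex_expR (Itv01 t0 t1) x y.
by rewrite !convRE.
Qed.

(** Here [h] and [k] stand for F on the two sections being mixed; they may be +oo, the value of F on
    an empty section. Hiding [t] leaves a condition on the two coefficients alone, which can then be
    taken rational. *)
Definition dominated (R : realType) (psi : R -> R) (a b : R) :=
  exists2 t : R, 0 <= t <= 1 &
    forall h k : \bar R, (0 <= h)%E -> (0 <= k)%E ->
      (expeR ((psi (1 - t))%:E + t%:E * h + (1 - t)%:E * k) <=
       a%:E * expeR h + b%:E * expeR k)%E.

(* Weighted AM-GM, normalised at the point [(c1, c2)] where it is an equality. *)
Lemma dominated_tangent (R : realType) (psi : R -> R) (t c1 c2 : R) :
  0 <= t <= 1 ->
  exists a0 b0, [/\ 0 <= a0, 0 <= b0, t = 0 -> a0 = 0,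
    a0 * expR c1 + b0 * expR c2 = expR (psi (1 - t) + t * c1 + (1 - t) * c2) &
    forall a b, a0 <= a -> b0 <= b -> dominated psi a b].
Proof.
move=> t01; set D := expR (psi (1 - t) + t * c1 + (1 - t) * c2).
have D0 : 0 < D by exact: expR_gt0.
(* The partial derivatives of exp(psi(1 - t)) X^t Y^(1 - t) at X = exp(c1), Y = exp(c2). *)
exists (t * D * expR (- c1)), ((1 - t) * D * expR (- c2)).
have e0 (x : R) := expR_gt0 x.
have eN (x : R) : expR (- x) * expR x = 1 by rewrite -expRD addNr expR0.
have t0 : 0 <= t by lra.
have t1 : 0 <= 1 - t by lra.
split.
- by rewrite !mulr_ge0// ltW.
- by rewrite !mulr_ge0// ltW.
- by move=> ->; rewrite !mul0r.
- rewrite -(mulrA _ (expR (- c1))) eN -(mulrA _ (expR (- c2))) eN; ring.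
move=> a b a0 b0; exists t => // h k h0 k0.
have A0 : 0 <= a by rewrite (le_trans _ a0)// !mulr_ge0// ltW.
have B0 : 0 <= b by rewrite (le_trans _ b0)// !mulr_ge0// ltW.
have real_case (x y : R) :
    expR (psi (1 - t) + t * x + (1 - t) * y) <= a * expR x + b * expR y.
  have -> : psi (1 - t) + t * x + (1 - t) * y =
      (psi (1 - t) + t * c1 + (1 - t) * c2) +
      (t * (x - c1) + (1 - t) * (y - c2)) by ring.
  rewrite expRD -/D; have := expR_convex_shift (x - c1) (y - c2) t01.
  rewrite -(ler_pM2l D0) => /le_trans; apply.
  rewrite [x - c1]addrC [y - c2]addrC !expRD.
  have -> : D * (t * (expR (- c1) * expR x) + (1 - t) * (expR (- c2) * expR y)) =
    (t * D * expR (- c1)) * expR x + ((1 - t) * D * expR (- c2)) * expR y by ring.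
  by rewrite lerD// ler_wpM2r// ltW.
have H0 : (0 <= a%:E * expeR h)%E by rewrite mule_ge0 ?lee_fin ?expeR_ge0.
have K0 : (0 <= b%:E * expeR k)%E by rewrite mule_ge0 ?lee_fin ?expeR_ge0.
have addy (u v : \bar R) : (0 <= v -> u = +oo -> u + v = +oo)%E.
  by move=> v0 ->; rewrite addye// gt_eqF// (lt_le_trans _ v0)// ltNyr.
(* Since 0 * +oo = 0, a zero weight hides an infinite value, so t = 0 and t = 1 are treated apart.
   Otherwise both coefficients are positive, and an infinite [h] or [k] makes the right side
   infinite. *)
have [ty|tN0] := eqVneq t 0.
  subst t; rewrite mul0e adde0 subr0 mul1e.
  case: k k0 K0 => [k| |]// k0 K0.
    have : expR (psi 1 + k) <= b * expR k.
      rewrite expRD ler_pM2r// (le_trans _ b0)//.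
      by rewrite /D subr0 mul0r addr0 !mul1r expRD -mulrA [_ * expR (- c2)]mulrC eN mulr1.
    move=> hk; apply: (le_trans _ (leeDr _ H0)).
    by rewrite /= -EFinM lee_fin.
  suff bky : (b%:E * expeR +oo = +oo)%E.
    by rewrite [X in (_ <= X)%E]addeC (addy _ _ H0 bky) leey.
  rewrite /= mulry gtr0_sg ?mul1e// (lt_le_trans _ b0)//.
  by rewrite subr0 mul1r mulr_gt0.
have tp : 0 < t by rewrite lt_def tN0.
have ap : 0 < a by rewrite (lt_le_trans _ a0)// !mulr_gt0.
case: h h0 H0 => [h| |]// h0 H0; last first.
  by rewrite [X in (_ <= X)%E]addy ?leey//= mulry gtr0_sg ?mul1e.
have [ty|sN0] := eqVneq (1 - t) 0.
  rewrite ty mul0e adde0; apply: (le_trans _ (leeDl _ K0)).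
  rewrite -EFinM -EFinD /= -EFinM lee_fin.
  rewrite (le_trans _ (ler_wpM2r (ltW (e0 h)) a0))//.
  have t1E : t = 1 by lra.
  have -> : t * D * expR (- c1) = expR (psi 0).
    rewrite /D ty t1E mul0r addr0 !mul1r expRD -mulrA [_ * expR (- c1)]mulrC.
    by rewrite eN mulr1.
  by rewrite t1E mul1r expRD.
have bp : 0 < b.
  by rewrite (lt_le_trans _ b0)// !mulr_gt0// lt_def sN0.
case: k k0 K0 => [k| |]// k0 K0; last first.
  by rewrite [X in (_ <= X)%E]addeC [X in (_ <= X)%E]addy ?leey//= mulry gtr0_sg ?mul1e.
by rewrite -!EFinM -!EFinD lee_fin; exact: real_case.
Qed.

(** * The functions exp(G(gamma(r) - gamma(s))) and the integral over the sections *)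

Section sections.
Context (R : realType) (psi : R -> R) (gamma : R -> \bar R).
Hypothesis psi_ge0 : forall r, 0 <= r <= 1 -> 0 <= psi r.
Hypothesis psi0 : psi 0 = 0.
Hypothesis gamma_decr : forall r s, 0 <= r -> r <= s -> s <= 1 ->
  (gamma s <= gamma r)%E.
Hypothesis gamma0 : gamma 0 = +oo%E.
Hypothesis gamma_fin : forall r, 0 < r <= 1 -> gamma r \is a fin_num.
Hypothesis hyp_i : forall r0, 0 < r0 <= 1 ->
  concave_function `[0, r0]
    (fun r => expR (G1 psi (gamma r - gamma r0)%E)).

Let g r := fine (gamma r).
Let phi s r := expR (G1 psi (gamma r - gamma s)%E).

Let gammaE r : 0 < r <= 1 -> gamma r = (g r)%:E.
Proof. by move=> /gamma_fin /fineK. Qed.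

Let g_decr r s : 0 < r -> r <= s -> s <= 1 -> g s <= g r.
Proof.
move=> r0 rs s1; have := gamma_decr (ltW r0) rs s1.
by rewrite !gammaE ?lee_fin//; lra.
Qed.

Let phi0 s : 0 < s <= 1 -> phi s 0 = expR (psi 1).
Proof. by move=> s01; rewrite /phi gamma0 (gammaE s01). Qed.

Let phiE s r : 0 < r <= 1 -> 0 < s <= 1 ->
  phi s r = expR (inf [set G2 psi (g r - g s) t | t in `[0, 1]]).
Proof. by move=> r01 s01; rewrite /phi (gammaE r01) (gammaE s01). Qed.

Let G2_ge0 s r t : 0 < r -> r <= s -> s <= 1 -> t \in `[0, 1]%R ->
  0 <= G2 psi (g r - g s) t.
Proof.
move=> r0 rs s1; rewrite in_itv /= => /andP[t0 t1].
by rewrite addr_ge0 ?psi_ge0 ?mulr_ge0 ?subr_ge0 ?g_decr//; lra.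
Qed.

Let has_infG2 s r : 0 < r -> r <= s -> s <= 1 ->
  has_inf [set G2 psi (g r - g s) t | t in `[0, 1]].
Proof.
move=> r0 rs s1; split.
  by exists (G2 psi (g r - g s) 0), 0 => //=; rewrite in_itv /= lexx ler01.
by exists 0 => _ [t /= t01 <-]; exact: G2_ge0.
Qed.

Let phi_ge1 s r : 0 < r -> r <= s -> s <= 1 -> 1 <= phi s r.
Proof.
move=> r0 rs s1; rewrite phiE; [|lra|lra].
rewrite -[leLHS]expR0 ler_expR.
apply: lb_le_inf; first exact: (has_infG2 r0 rs s1).1.
by move=> _ [t /= t01 <-]; exact: G2_ge0.
Qed.

Let phi_ub s r : 0 < r -> r <= s -> s <= 1 -> phi s r <= expR (g r - g s).
Proof.
move=> r0 rs s1; rewrite phiE; [|lra|lra].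
rewrite ler_expR; apply: ge_inf; first exact: (has_infG2 r0 rs s1).2.
by exists 1; rewrite /= ?in_itv /= ?lexx ?ler01// /G2 subrr psi0 add0r mul1r.
Qed.

Let phi_le s r : 0 < r -> r <= s -> s <= 1 -> phi s r <= expR (psi 1).
Proof.
move=> r0 rs s1; rewrite phiE; [|lra|lra].
rewrite ler_expR; apply: ge_inf; first exact: (has_infG2 r0 rs s1).2.
by exists 0; rewrite /= ?in_itv /= ?lexx ?ler01// /G2 subr0 mul0r addr0.
Qed.

(** The bound with coefficient [t] is exp(g s) times exp(G2(g r - g s, t)), so optimising over [t]
    produces the infimum in [phi]. *)
Let phi_lb s r (u : \bar R) : 0 < r -> r <= s -> s <= 1 ->
  (forall t, 0 <= t <= 1 ->
    (u <= (expR (psi (1 - t) + t * g r + (1 - t) * g s))%:E)%E) ->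
  (u <= (expR (g s) * phi s r)%:E)%E.
Proof.
move=> r0 rs s1 hu.
case: u hu => [u| |] hu; last by rewrite leNye.
- rewrite lee_fin; have [u0|u0] := leP u 0.
    by rewrite (le_trans u0)// mulr_ge0 ?expR_ge0.
  rewrite phiE; [|lra|lra].
  rewrite -expRD -ler_ln ?posrE ?expR_gt0// expRK -lerBlDl.
  apply: lb_le_inf; first exact: (has_infG2 r0 rs s1).1.
  move=> _ [t /= + <-]; rewrite in_itv /= => t01.
  have := hu t t01; rewrite lee_fin -ler_ln ?posrE ?expR_gt0// expRK /G2.
  by nra.
- by have := hu 0; rewrite lexx ler01 leye_eq => /(_ isT).
Qed.

Let null_gt d (T : measurableType d) (Q : probability T R) (r : T -> R) (c : R) :
  measurable_fun setT r ->
  (forall s, c < s -> Q [set t | s <= r t] = 0%E) ->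
  Q.-negligible [set t | c < r t].
Proof.
move=> mr h.
have -> : [set t | c < r t] =
    \bigcup_k [set t | c + k.+1%:R^-1 <= r t].
  apply/seteqP; split => t /=.
    rewrite -subr_gt0 => rt; have [k _ hk] := near_infty_natSinv_lt (PosNum rt).
    by exists k => //=; have := hk k (leqnn k); rewrite /= ltrBrDl => /ltW.
  by move=> [k _ /=]; apply: lt_le_trans; rewrite ltrDl invr_gt0.
apply: negligible_bigcup => k; apply/negligibleP.
  by rewrite -[X in measurable X]setTI -preimage_itvcy; exact: mr.
by apply: h; rewrite ltrDl invr_gt0.
Qed.

(* [r t] is the probability of the section at [t] and [J t] the integral over
   that section. Mixing with sections of probability at least [s], for [s] below
   but close to the essential supremum of [r], and optimising over [c], gives
   [J t <= exp (gamma s) * phi s (r t)]. The integral is then bounded by means of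
   a supporting line of the concave function [phi s] at [p], whose slope stays
   bounded as [s] increases. *)
Lemma integral_sections_le d (T : measurableType d) (Q : probability T R)
    (r : T -> R) (J : T -> \bar R) (p : R) :
  measurable_fun setT r -> (forall t, 0 <= r t <= 1) ->
  measurable_fun setT J -> (forall t, 0 <= J t)%E ->
  (forall t, J t <= expeR (gamma (r t)))%E ->
  (forall t (q : rat), 0 < (ratr q : R) <= 1 ->
    (0 < Q [set m | (ratr q <= r m)%R])%E ->
    forall c, 0 <= c <= 1 -> (r t = 0 -> c = 0) ->
    (J t <= (expR (psi (1 - c) + c * g (r t) + (1 - c) * g (ratr q)))%:E)%E) ->
  (\int[Q]_t (r t)%:E = p%:E)%E ->
  (\int[Q]_t J t <= expeR (gamma p))%E.
Proof.
move=> mr r01 mJ J0 J1 J2 rp.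
have mre : measurable_fun setT (EFin \o r) by exact/measurable_EFinP.
have mle s : measurable [set t | s <= r t].
  by rewrite -[X in measurable X]setTI -preimage_itvcy; exact: mr.
have p0 : 0 <= p.
  rewrite -lee_fin -rp; apply: integral_ge0 => t _.
  by rewrite lee_fin; have /andP[] := r01 t.
have p1 : p <= 1.
  rewrite -lee_fin -rp -(probability_setT Q) -[X in (_ <= X)%E]mul1e.
  rewrite -integral_cst//; apply: ge0_le_integral => //.
  - by move=> t _; rewrite lee_fin; have /andP[] := r01 t.
  - by move=> t _; rewrite lee_fin; have /andP[] := r01 t.
have [p_eq0|p_neq0] := eqVneq p 0; first by rewrite p_eq0 gamma0 leey.
have p_gt0 : 0 < p by rewrite lt_def p_neq0.
have p01 : 0 < p <= 1 by rewrite p_gt0.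
have ir : Q.-integrable setT (EFin \o r).
  apply/integrableP; split => //.
  rewrite (eq_integral (EFin \o r)); first by rewrite rp ltry.
  by move=> t _ /=; rewrite ger0_norm//; have /andP[] := r01 t.
have iaff (a b : R) : Q.-integrable setT (EFin \o (fun t => a + b * r t)).
  rewrite (_ : _ \o _ = (EFin \o cst a) \+ (fun t => b%:E * (EFin \o r) t))%E; last first.
    by apply/funext => t /=.
  by apply: integrableD => //; [exact: finite_measure_integrable_cst|exact: integrableZl].
have Iaff (a b : R) : (\int[Q]_t (a + b * r t)%:E = (a + b * p)%:E)%E.
  under eq_integral do rewrite EFinD EFinM.
  rewrite integralD//; last 2 first.
  - exact: finite_measure_integrable_cst.
  - exact: integrableZl.
  rewrite integralZl// rp -EFinM EFinD; congr (_ + _)%E.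
  by rewrite (integral_cst Q measurableT a%:E) /= (probability_setT Q) mule1.
(* The supremum of [S] is the essential supremum of [r]. *)
pose S := [set s | (0 < Q [set t | (s <= r t)%R])%E].
have S0 : S 0%R.
  rewrite /S /= (_ : [set t | _] = setT) ?probability_setT ?lte01//.
  by apply/seteqP; split => t //= _; have /andP[] := r01 t.
have S1 : ubound S 1.
  move=> s /= Ss; rewrite leNgt; apply/negP => s1; move: Ss.
  rewrite /S /= (_ : [set t | _] = set0) ?measure0 ?ltxx//.
  by apply/seteqP; split => t //= srt; have := r01 t; lra.
have hS : has_sup S by split; [exists 0|exists 1].
have S_gt s : sup S < s -> Q [set t | s <= r t] = 0%E.
  move=> Ss; apply/eqP; rewrite eq_le measure_ge0 andbT leNgt; apply/negP => Ps.
  by have := ub_le_sup hS.2 Ps; rewrite leNgt Ss.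
have nS : Q.-negligible [set t | sup S < r t] by exact: null_gt.
(* If [r] is essentially at most its mean [p], then r = p almost everywhere and the bound [J1]
   suffices. *)
have [Sp|pS] := leP (sup S) p.
  have rp_ae : ae_eq Q setT (EFin \o (fun t => p + - 1 * r t)) (cst 0%E).
    apply/ae_eq_integral_abs => //; first by have /integrableP[] := iaff p (-1).
    rewrite (@ae_eq_integral _ _ _ Q setT (EFin \o (fun t => p + - 1 * r t)))//.
    - by rewrite Iaff mulN1r subrr.
    - by apply: measurableT_comp => //; have /integrableP[] := iaff p (-1).
    - by have /integrableP[] := iaff p (-1).
    apply: negligibleS nS => t /= /not_implyP[_]; apply: contra_notP => /negP.
    rewrite -leNgt => rtS; rewrite ger0_norm//.
    by have := le_trans rtS Sp; lra.
  rewrite [leRHS](_ : _ = \int[Q]_t (cst (expeR (gamma p)) t))%E; last first.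
    rewrite (integral_cst Q measurableT (expeR (gamma p))) /=.
    by rewrite (probability_setT Q) mule1.
  apply: ae_ge0_le_integral => //.
  - by move=> t _; exact: expeR_ge0.
  - apply: filterS rp_ae => t /(_ I) /= [rtp] _.
    by rewrite (le_trans (J1 t))// (_ : r t = p)//; lra.
(* The point [s1] is fixed before [s]: it keeps s - p away from 0 and bounds exp(g s) by exp(g s1),
   so that [C] and [dl] do not depend on [s]. *)
have [q1] := rat_in_itvoo pS; rewrite in_itv /= => /andP[pq1 q1S].
set s1 : R := ratr q1 in pq1 q1S.
have supS1 : sup S <= 1 by apply: ge_sup => //; exists 0.
pose E := expR (psi 1); have E0 : 0 < E := expR_gt0 _.
pose C := E / (s1 - p) + E / p.
have C0 : 0 < C by rewrite addr_gt0 ?divr_gt0 ?subr_gt0.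
rewrite (gammaE p01) /=.
apply/lee_addgt0Pr => e e0.
pose dl := e / (expR (g s1) * C).
have dl0 : 0 < dl by rewrite divr_gt0 ?mulr_gt0 ?expR_gt0.
have : Num.max s1 (sup S - dl) < sup S by rewrite gt_max q1S ltrBlDr ltrDl.
move=> /rat_in_itvoo[q]; rewrite in_itv /= gt_max -andbA => /and3P[s1q qdl qS].
set s : R := ratr q in s1q qdl qS.
have s01 : 0 < s <= 1 by lra.
have Ss : (0 < Q [set m | (ratr q <= r m)%R])%E.
  have sS0 : 0 < sup S - s by rewrite subr_gt0.
  have [s' Ss'] := sup_adherent sS0 hS; rewrite subKr => ss'.
  apply: (lt_le_trans Ss'); apply: le_measure; rewrite ?inE//.
  by move=> t /=; apply: le_trans; exact: ltW.
have ps : 0 < p < s by lra.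
have [a /= ha] := concave_supporting_line ps (hyp_i s01).
have {}ha u : 0 <= u <= s -> phi s u <= phi s p + a * (u - p) := ha u.
have phip : phi s p <= E by apply: phi_le; lra.
(* At [s] the line lies above the positive number [phi s s], and at 0 above [E]; with 0 < phi s p <=
   E this bounds the slope on both sides. *)
have a_lb : - C <= a.
  have := ha s; rewrite lexx andbT (_ : 0 <= s); last lra.
  move=> /(_ isT); have := expR_gt0 (G1 psi (gamma s - gamma s)%E).
  rewrite -/(phi s s) => h1 h2.
  have : - E <= a * (s - p) by lra.
  rewrite -ler_pdivrMr; last lra.
  apply: le_trans; rewrite lerNl mulNr opprK.
  apply: (@le_trans _ _ (E / (s1 - p))); last by rewrite lerDl divr_ge0// ltW.
  by rewrite ler_pM2l// lef_pV2 ?posrE; lra.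
have a_ub : a <= C.
  have := ha 0; rewrite lexx (_ : 0 <= s) ?(phi0 s01); last lra.
  move=> /(_ isT) h.
  have : a * p <= E by rewrite -/E in h; lra.
  rewrite -ler_pdivlMr// => /le_trans; apply.
  by rewrite lerDr divr_ge0//; lra.
(* The supporting line, raised by C * dl to absorb its possible descent between [s] and [sup S],
   which are less than [dl] apart; concavity says nothing there. *)
pose f t := expR (g s) * (phi s p - a * p + C * dl) + expR (g s) * a * r t.
have Jf t : r t <= sup S -> (J t <= (f t)%:E)%E.
  move=> rtS; have /andP[r0 r1] := r01 t.
  have gs0 := expR_gt0 (g s).
  have [rs|sr] := leP (r t) s; last first.
    apply: (le_trans (J1 t)); rewrite (gammaE (r := r t)) /=; last lra.
    rewrite lee_fin.
    apply: (@le_trans _ _ (expR (g s) * 1)).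
      by rewrite mulr1 ler_expR g_decr//; lra.
    rewrite /f -mulrA -mulrDr ler_pM2l//.
    have h1 : 1 <= phi s s by apply: phi_ge1; lra.
    have h2 : phi s s <= phi s p + a * (s - p) by apply: ha; lra.
    by nra.
  have Jphi : (J t <= (expR (g s) * phi s (r t))%:E)%E.
    (* At r t = 0 the real [g (r t)] is only the default value of [fine +oo]; the coefficient c = 0
       avoids it and yields [phi s 0]. *)
    have [rt0|rtN0] := eqVneq (r t) 0.
      rewrite rt0 phi0//.
      have := J2 t q s01 Ss 0; rewrite lexx ler01 => /(_ isT (fun=> erefl)).
      by rewrite subr0 mul0r addr0 mul1r -expRD addrC.
    have rt0 : 0 < r t by rewrite lt_def rtN0.
    apply: phi_lb => //; first lra.
    move=> c c01; apply: (J2 t q) => // rt0'.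
    by rewrite rt0' ltxx in rt0.
  apply: (le_trans Jphi); rewrite lee_fin /f -mulrA -mulrDr ler_pM2l//.
  have h2 : phi s (r t) <= phi s p + a * (r t - p) by apply: ha; lra.
  by have := mulr_gt0 C0 dl0; lra.
have ifn : Q.-integrable setT (EFin \o f) by exact: iaff.
have mf : measurable_fun setT (EFin \o f) by have /integrableP[] := ifn.
(* Nonnegativity of [f] is known only almost everywhere, hence the detour through its absolute
   value. *)
apply: (@le_trans _ _ (\int[Q]_t `|(f t)%:E|)%E).
  apply: ae_ge0_le_integral => //.
  - by apply: measurableT_comp mf.
  - apply: negligibleS nS => t /= /not_implyP[_]; apply: contra_notP => /negP.
    by rewrite -leNgt => /Jf /le_trans; apply; exact: lee_abs.
rewrite (@ae_eq_integral _ _ _ Q setT (EFin \o f))//; last 2 first.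
- by apply: measurableT_comp mf.
- apply: negligibleS nS => t /= /not_implyP[_]; apply: contra_notP => /negP.
  by rewrite -leNgt => /Jf h; rewrite ger0_norm// -lee_fin; exact: le_trans h.
rewrite Iaff -EFinD lee_fin.
have -> : expR (g s) * (phi s p - a * p + C * dl) + expR (g s) * a * p =
  expR (g s) * phi s p + expR (g s) * C * dl by ring.
(* The line takes the value [phi s p] at the mean, and G(eta) <= eta gives exp(g s) * phi s p <=
   exp(g p). *)
apply: lerD.
  have : phi s p <= expR (g p - g s) by apply: phi_ub; lra.
  by rewrite -(ler_pM2l (expR_gt0 (g s))) -[leRHS]expRD subrKC.
rewrite -[leRHS](@divfK _ (expR (g s1) * C)) ?gt_eqF ?mulr_gt0 ?expR_gt0//.
rewrite mulrC ler_pM2l// ler_pM2r// ler_expR g_decr//; lra.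
Qed.

End sections.

(** * Images and mixtures of probabilities, and inner measures *)

Lemma image_probability (R : realType) d d' (T : measurableType d)
    (T' : measurableType d') (P : probability T R) (f : T -> T') :
  measurable_fun setT f ->
  exists nu : probability T' R, (forall B, nu B = P (f @^-1` B)) /\
    forall h, measurable_fun setT h -> (forall y, 0 <= h y)%E ->
      (\int[nu]_y h y = \int[P]_x h (f x))%E.
Proof.
move=> mf; pose F : {mfun T >-> T'} := HB.pack f (isMeasurableFun.Build _ _ _ _ _ mf).
exists (distribution P F); split => // h mh h0.
exact: ge0_integral_pushforward.
Qed.

Lemma mixture_probability (R : realType) d (T : measurableType d)
    (P1 P2 : probability T R) (t : R) : 0 <= t <= 1 ->
  exists nu : probability T R,
    forall B, (nu B = t%:E * P1 B + (1 - t)%:E * P2 B)%E.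
Proof.
move=> /andP[t0 t1]; have t1' : 0 <= 1 - t by rewrite subr_ge0.
pose m : {measure set T -> \bar R} :=
  measure_add (mscale (NngNum t0) P1) (mscale (NngNum t1') P2).
have mE B : (m B = t%:E * P1 B + (1 - t)%:E * P2 B)%E by exact: measure_addE.
have m1 : m setT = 1%E.
  by rewrite mE (probability_setT P1) (probability_setT P2) !mule1 -EFinD subrKC.
(* As [m] has mass 1, normalising changes nothing and only supplies the structure of a
   probability. *)
exists (mnormalize m P1) => B.
by rewrite /= /mnormalize m1 onee_eq0 /= invr1 mule1 mE.
Qed.

Section inner_measure.
Context (R : realType) d (T : measurableType d).
Implicit Types (nu : probability T R) (S : set T).

Lemma inner_measure_ge0 nu S : (0 <= inner_measure nu S)%E.
Proof. by apply: ereal_sup_ubound; exists set0; [split|exact: measure0]. Qed.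

Lemma inner_measure_le1 nu S : (inner_measure nu S <= 1)%E.
Proof. by apply: ge_ereal_sup => _ [B [mB _] <-]; exact: probability_le1. Qed.

Lemma inner_measure_fin_num nu S : inner_measure nu S \is a fin_num.
Proof.
rewrite ge0_fin_numE ?inner_measure_ge0//.
by rewrite (le_lt_trans (inner_measure_le1 nu S))// ltry.
Qed.

Lemma fine_inner_measure_ge0 nu S : 0 <= fine (inner_measure nu S).
Proof. by rewrite fine_ge0// inner_measure_ge0. Qed.

Lemma fine_inner_measure_le1 nu S : fine (inner_measure nu S) <= 1.
Proof. by rewrite -lee_fin fineK ?inner_measure_fin_num ?inner_measure_le1. Qed.

Lemma le_inner_measure nu B S : measurable B -> B `<=` S ->
  (nu B <= inner_measure nu S)%E.
Proof. by move=> mB BS; apply: ereal_sup_ubound; exists B. Qed.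

End inner_measure.

(** * The recursive inequality for F *)

Section Fpsi_cons.
Context (R : realType) d (T : measurableType d) (psi : R -> R).
Hypothesis psi_ge0 : forall r, 0 <= r <= 1 -> 0 <= psi r.
Hypothesis psi_convex : convex_function (`[0, 1] : set R^o) (psi : R^o -> R^o).
Hypothesis psi_incr : forall r s, 0 <= r -> r <= s -> s <= 1 -> psi r <= psi s.

Let cost n (nu : probability (n.-tuple T) R) (x : n.-tuple T)
    (A : set (n.-tuple T)) (i : 'I_n) : R :=
  fine (inner_measure nu [set y | A y /\ tnth y i <> tnth x i]).

Lemma Fpsi_ge0 n (x : n.-tuple T) (A : set (n.-tuple T)) : (0 <= Fpsi psi x A)%E.
Proof.
apply: le_ereal_inf_tmp => _ [nu _ <-]; rewrite lee_fin sumr_ge0// => i _.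
by rewrite psi_ge0// fine_inner_measure_ge0 fine_inner_measure_le1.
Qed.

Definition section n (A : set (n.+1.-tuple T)) (u : T) : set (n.-tuple T) :=
  [set y : n.-tuple T | A [tuple of u :: y]].

Lemma measurable_tuple_cons n (u : T) :
  measurable_fun setT (fun y : n.-tuple T => [tuple of u :: y] : n.+1.-tuple T).
Proof. exact: measurable_cons. Qed.

Lemma measurable_section n (A : set (n.+1.-tuple T)) (u : T) :
  measurable A -> measurable (section A u).
Proof.
move=> mA; rewrite -[X in measurable X]setTI.
exact: measurable_tuple_cons.
Qed.

(** Put [u] in front of [nu1], [m] in front of [nu2], and mix. The first coordinate differs from [u]
    with mass at most 1 - t; the other coordinates are handled by convexity of [psi]. A measure of
    weight 0 is left unconstrained because its section may be empty. *)
Let Fpsi_mixture n (A : set (n.+1.-tuple T)) (u m : T) (y : n.-tuple T) (t : R)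
    (nu1 nu2 : probability (n.-tuple T) R) : measurable A -> 0 <= t <= 1 ->
  (t != 0 -> nu1 (section A u) = 1%E) ->
  (1 - t != 0 -> nu2 (section A m) = 1%E) ->
  (Fpsi psi [tuple of u :: y] A <=
   (psi (1 - t) + t * \sum_(i < n) psi (cost nu1 y (section A u) i)
     + (1 - t) * \sum_(i < n) psi (cost nu2 y (section A m) i))%:E)%E.
Proof.
move=> mA t01 h1 h2.
have /andP[t0 t1] := t01.
have [P1 [P1E _]] := image_probability nu1 (@measurable_tuple_cons n u).
have [P2 [P2E _]] := image_probability nu2 (@measurable_tuple_cons n m).
have [nu nuE] := mixture_probability P1 P2 t01.
have {}nuE B : (nu B = t%:E * nu1 (section B u) + (1 - t)%:E * nu2 (section B m))%E.
  by rewrite nuE P1E P2E.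
have nuA : nu A = 1%E.
  rewrite nuE; have [t_eq0|/h1 ->] := eqVneq t 0.
    by rewrite t_eq0 mul0e add0e subr0 mul1e h2// t_eq0 subr0 oner_neq0.
  have [ct0|/h2 ->] := eqVneq (1 - t) 0; last by rewrite !mule1 -EFinD subrKC.
  by rewrite ct0 mul0e adde0 mule1; congr EFin; lra.
apply: (@le_trans _ _ (\sum_(i < n.+1) psi (cost nu [tuple of u :: y] A i))%:E).
  by apply: ereal_inf_lbound; exists nu.
rewrite lee_fin big_ord_recl -addrA lerD//.
  apply: psi_incr; [exact: fine_inner_measure_ge0| |lra].
  rewrite -lee_fin fineK ?inner_measure_fin_num//.
  apply: ge_ereal_sup => _ [B [mB BS] <-].
  (* Points of [B] do not start with [u], so only the part of weight 1 - t charges [B]. *)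
  rewrite nuE (_ : section B u = set0) ?measure0 ?mule0 ?add0e.
    rewrite -[leRHS]mule1 lee_wpmul2l ?lee_fin; [by []|lra|].
    by apply: probability_le1; exact: measurable_section.
  by apply/seteqP; split => // z /= /BS[_]; rewrite tnth0.
rewrite !mulr_sumr -big_split /=; apply: ler_sum => i _.
have c01 (P : probability (n.-tuple T) R) S : 0 <= fine (inner_measure P S) <= 1.
  by rewrite fine_inner_measure_ge0 fine_inner_measure_le1.
have := convex_function_itvP psi_convex t01 (c01 nu1 _) (c01 nu2 _).
move=> h; apply: le_trans (h _ _); apply: psi_incr.
- exact: fine_inner_measure_ge0.
- rewrite -lee_fin fineK ?inner_measure_fin_num//.
  apply: ge_ereal_sup => _ [B [mB BS] <-].
  rewrite nuE [leRHS]EFinD !EFinM !fineK ?inner_measure_fin_num//.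
  by apply: leeD; (apply: lee_wpmul2l; first by rewrite lee_fin; lra);
    apply: le_inner_measure; [exact: measurable_section| |
      exact: measurable_section|] => z /= /BS[]; rewrite !tnthS.
- rewrite -[leRHS](subrKC t); apply: lerD.
    by rewrite ler_piMr// fine_inner_measure_le1.
  by rewrite ler_piMr ?subr_ge0// fine_inner_measure_le1.
Qed.

(** Mix nearly optimal measures for the two sections; the errors t * e and (1 - t) * e add up to
    [e]. *)
Lemma Fpsi_cons n (A : set (n.+1.-tuple T)) (u m : T) (y : n.-tuple T) (t : R) :
  measurable A -> 0 <= t <= 1 ->
  (Fpsi psi [tuple of u :: y] A <= (psi (1 - t))%:E
    + t%:E * Fpsi psi y (section A u) + (1 - t)%:E * Fpsi psi y (section A m))%E.
Proof.
move=> mA t01; have /andP[t0 t1] := t01.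
have ct0 : 0 <= 1 - t by rewrite subr_ge0.
apply/lee_addgt0Pr => e e0.
(* Either [w * F = +oo], or a nearly optimal measure exists as soon as [w > 0]. *)
have near_opt (w : R) (B : set (n.-tuple T)) : 0 <= w ->
    (w%:E * Fpsi psi y B = +oo)%E \/
    exists nu : probability (n.-tuple T) R, (w != 0 -> nu B = 1%E) /\
      ((w * \sum_(i < n) psi (cost nu y B i))%:E <= w%:E * Fpsi psi y B + (w * e)%:E)%E.
  move=> w0; have [->|wN0] := eqVneq w 0.
    by right; exists (dirac y); split; rewrite ?eqxx// !mul0r mul0e adde0.
  have wp : 0 < w by rewrite lt_def wN0.
  have [Foo|Ffin] := eqVneq (Fpsi psi y B) +oo%E.
    by left; rewrite Foo mulry gtr0_sg ?mul1e.
  have Ff : Fpsi psi y B \is a fin_num.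
    by rewrite ge0_fin_numE ?Fpsi_ge0// lt_neqAle Ffin leey.
  right; have [_ [nu nuB <-] Fe] := lb_ereal_inf_adherent e0 Ff.
  exists nu; split => //.
  rewrite !EFinM -muleDr//; last by rewrite ge0_adde_def// inE ?Fpsi_ge0// lee_fin ltW.
  by rewrite lee_pmul2l// ltW.
have ge0N (x : \bar R) : (0 <= x -> x != -oo)%E by case: x.
have mF0 (w : R) (B : set (n.-tuple T)) : 0 <= w -> (0 <= w%:E * Fpsi psi y B)%E.
  by move=> w0; rewrite mule_ge0 ?Fpsi_ge0.
have [->|[nu1 [n1 s1]]] := near_opt t (section A u) t0.
  by rewrite addey// addye ?ge0N ?mF0// addye// leey.
have [->|[nu2 [n2 s2]]] := near_opt (1 - t) (section A m) ct0.
  rewrite addey ?addye ?leey// ge0N// adde_ge0 ?mF0// lee_fin psi_ge0//; lra.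
apply: (le_trans (Fpsi_mixture y mA t01 n1 n2)).
have -> : e%:E = ((t * e)%:E + ((1 - t) * e)%:E)%E by rewrite -EFinD; congr EFin; ring.
by rewrite addeACA -[X in (_ <= X + _)%E]addeA !EFinD; apply: leeD => //; apply: leeD.
Qed.

End Fpsi_cons.

(** * Product laws on tuples and their disintegration along the first coordinate *)

Definition product_rule (R : realType) d (T : measurableType d) n
    (mu : probability (n.-tuple T) R) :=
  forall B : 'I_n -> set T, (forall i, measurable (B i)) ->
    mu [set x | forall i, B i (tnth x i)] =
    (\prod_(i < n) mu [set x | B i (tnth x i)])%E.

Definition boxes d (T : measurableType d) n : set (set (n.-tuple T)) :=
  [set [set x | forall i, B i (tnth x i)] |
    B in [set B : 'I_n -> set T | forall i, measurable (B i)]].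

Lemma measurable_tnth_preimage d (T : measurableType d) n (i : 'I_n) (B : set T) :
  measurable B -> measurable [set x : n.-tuple T | B (tnth x i)].
Proof.
move=> mB; rewrite -[X in measurable X]setTI.
exact: (@measurable_tnth _ T n i).
Qed.

Lemma measurable_box d (T : measurableType d) n (B : 'I_n -> set T) :
  (forall i, measurable (B i)) ->
  measurable [set x : n.-tuple T | forall i, B i (tnth x i)].
Proof.
move=> mB; rewrite (_ : [set x | _] = \bigcap_i [set x | B i (tnth x i)]).
  apply: fin_bigcap_measurable; first exact: finite_finset.
  by move=> i _; exact: measurable_tnth_preimage.
by apply/seteqP; split => x /= h i; [move=> _|]; exact: h.
Qed.

Lemma tuple_measurableE d (T : measurableType d) n :
  @measurable _ (n.-tuple T) = <<s @boxes d T n >>.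
Proof.
apply/seteqP; split; last first.
  apply: smallest_sub; first exact: sigma_algebra_measurable.
  by move=> _ [B mB <-]; exact: measurable_box.
apply: smallest_sub; first exact: smallest_sigma_algebra.
move=> A; rewrite -bigcup_seq /= => -[i _ [C mC <-]].
apply: sub_sigma_algebra; exists (fun j => if j == i then C else setT) => /=.
  by move=> j; case: ifP.
apply/seteqP; split => x /=.
  by move=> /(_ i); rewrite eqxx.
by move=> [_ Cx] j; case: eqP => // ->.
Qed.

Lemma boxes_setI d (T : measurableType d) n : setI_closed (@boxes d T n).
Proof.
move=> _ _ [B mB <-] [C mC <-]; exists (fun i => B i `&` C i).
  by move=> i; exact: measurableI.
apply/seteqP; split => x /= => [h|[h1 h2] i]; last by split; [exact: h1|exact: h2].
by split => i; have [] := h i.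
Qed.

(** [Q] and [mu'] are the laws of head and tail. The image of their product agrees with [mu] on
    boxes, a generating family closed under intersection, hence everywhere; Tonelli then splits the
    integral. *)
Lemma product_rule_cons (R : realType) d (T : measurableType d) n
    (mu : probability (n.+1.-tuple T) R) : product_rule mu ->
  exists (Q : probability T R) (mu' : probability (n.-tuple T) R),
    product_rule mu' /\
    forall f : n.+1.-tuple T -> \bar R,
      measurable_fun setT f -> (forall x, 0 <= f x)%E ->
      (\int[mu]_x f x = \int[Q]_u \int[mu']_y f [tuple of u :: y])%E.
Proof.
move=> pr.
have mhead : measurable_fun setT (fun x : n.+1.-tuple T => tnth x ord0).
  exact: measurable_tnth.
have [Q [QE _]] := image_probability mu mhead.
pose b (x : n.+1.-tuple T) : n.-tuple T := [tuple of behead x].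
have mb : measurable_fun setT b := @measurable_behead _ T n.
have [mu' [mu'E _]] := image_probability mu mb.
have tnthb (x : n.+1.-tuple T) i : tnth (b x) i = tnth x (lift ord0 i).
  by rewrite [x in RHS]tuple_eta tnthS.
exists Q, mu'.
have pr' : product_rule mu'.
  move=> B mB; rewrite mu'E.
  pose C (i : 'I_n.+1) := if unlift ord0 i is Some j then B j else setT.
  have mC i : measurable (C i) by rewrite /C; case: unliftP.
  have C0 : C ord0 = setT by rewrite /C unlift_none.
  have CS j : C (lift ord0 j) = B j by rewrite /C liftK.
  rewrite (_ : _ @^-1` _ = [set x | forall i, C i (tnth x i)]).
    rewrite pr// big_ord_recl C0 (_ : [set x | _] = setT); last exact/seteqP.
    rewrite (probability_setT mu) mul1e; apply: eq_bigr => i _.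
    by rewrite mu'E CS; congr (mu _); apply/seteqP; split => x /=; rewrite tnthb.
  apply/seteqP; split => x /= h i; last by rewrite tnthb -CS.
  by have [j ->|->] := unliftP ord0 i; [rewrite CS -tnthb|rewrite C0].
split => // f mf f0.
have mcons : measurable_fun setT
    (fun uy : T * n.-tuple T => [tuple of uy.1 :: uy.2] : n.+1.-tuple T).
  exact: measurable_cons.
have [N [NE IN]] := image_probability (Q \x mu')%E mcons.
have muN B : measurable B -> mu B = N B.
  apply: (measure_unique (@boxes d T n.+1) (fun=> setT)) => //.
  - exact: tuple_measurableE.
  - exact: boxes_setI.
  - by move=> _; exists (fun=> setT) => //; apply/seteqP.
  - by apply/seteqP; split => // x _; exists 0%N.
  - move=> _ [C mC <-]; etransitivity; first exact: (pr C mC).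
    apply/esym; etransitivity; first exact: NE.
    rewrite big_ord_recl.
    rewrite (_ : _ @^-1` _ = C ord0 `*` [set y | forall i, C (lift ord0 i) (tnth y i)]).
      transitivity (Q (C ord0) * mu' [set y | forall i, C (lift ord0 i) (tnth y i)])%E.
        have mB := measurable_box (fun i => mC (lift ord0 i)).
        exact: (product_measure1E Q mu' (mC ord0) mB).
      rewrite QE (pr' (fun i => C (lift ord0 i)) (fun i => mC _)).
      congr (_ * _)%E; apply: eq_bigr => i _.
      by rewrite mu'E; congr (mu _); apply/seteqP; split => x /=; rewrite tnthb.
    apply/seteqP; split => -[u y] /= h.
      split => [|i]; first by have := h ord0; rewrite tnth0.
      by have := h (lift ord0 i); rewrite tnthS.
    move=> i; have [j ->|->] := unliftP ord0 i; first by rewrite tnthS; exact: h.2.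
    by rewrite tnth0; exact: h.1.
  - by move=> _; apply: (le_lt_trans (probability_le1 mu measurableT)); rewrite ltry.
transitivity (\int[N]_x f x)%E.
  by apply: eq_measure_integral => B mB _; exact: muN.
rewrite IN// fubini_tonelli1//.
exact: measurableT_comp.
Qed.

Lemma product_rule_section (R : realType) d (T : measurableType d) n
    (mu : probability (n.+1.-tuple T) R) (Q : probability T R)
    (mu' : probability (n.-tuple T) R) :
  (forall f : n.+1.-tuple T -> \bar R,
      measurable_fun setT f -> (forall x, 0 <= f x)%E ->
      (\int[mu]_x f x = \int[Q]_u \int[mu']_y f [tuple of u :: y])%E) ->
  forall A, measurable A -> (mu A = \int[Q]_u mu' (section A u))%E.
Proof.
move=> h A mA; rewrite -[in LHS](setIT A) -integral_indic// h//.
  apply: eq_integral => u _; rewrite -[in RHS](setIT (section A u)).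
  by rewrite -integral_indic//; exact: measurable_section.
exact/measurable_EFinP.
Qed.

(** * Averaging over sections, measurable majorants and the base case *)

Lemma einfs0 (R : realType) (v : (\bar R)^nat) : einfs v 0 = ereal_inf (range v).
Proof.
congr ereal_inf; apply/seteqP; split => _ /= [k _ <-]; exists k => //.
Qed.

(* A bound by [c + b' * k m] valid for every [m] is averaged over [D]; this
   replaces a measurable choice of [m]. *)
Lemma le_average (R : realType) d (T : measurableType d) (Q : probability T R)
    (D : set T) (k : T -> \bar R) (v c : \bar R) (b b' : R) (m0 : T) :
  measurable D -> measurable_fun setT k -> (forall m, 0 <= k m)%E ->
  (0 <= v)%E -> (0 <= c)%E -> 0 <= b -> 0 <= b' ->
  (b'%:E <= b%:E * Q D)%E -> (forall m, v <= c + b'%:E * k m)%E ->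
  (v <= c + b%:E * \int[Q]_(m in D) k m)%E.
Proof.
move=> mD mk k0 v0 c0 b0 b'0 bb' vk.
have I0 : (0 <= \int[Q]_(m in D) k m)%E by exact: integral_ge0.
have mkD : measurable_fun D k by exact: measurable_funS mk.
have Df : Q D \is a fin_num by exact: fin_num_measure.
(* If [D] is null then b' = 0, and the bound at the single point [m0] is enough. *)
have [D0|DN0] := eqVneq (Q D) 0%E.
  have b'E : b' = 0.
    by apply/eqP; rewrite eq_le b'0 andbT -lee_fin (le_trans bb')// D0 mule0.
  have := vk m0; rewrite b'E mul0e adde0 => /le_trans; apply.
  by rewrite leeDl// mule_ge0.
have D_gt0 : (0 < Q D)%E by rewrite lt_def DN0 measure_ge0.
rewrite -(@lee_pmul2r _ (Q D))// -(integral_cst Q mD v).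
apply: (@le_trans _ _ (\int[Q]_(m in D) (c + b'%:E * k m))%E).
  apply: ge0_le_integral => //.
  by apply: emeasurable_funD => //; exact: measurable_funeM.
rewrite ge0_integralD//; last 2 first.
- by move=> m _; rewrite mule_ge0.
- exact: measurable_funeM.
rewrite (integral_cst Q mD c) ge0_integralZl//.
rewrite ge0_muleDl ?mule_ge0// leeD// muleAC.
by rewrite lee_wpmul2r.
Qed.

(* The parameter space [Z] stands for the coordinates already split off; asking
   for joint measurability in them is what makes the induction go through. *)
Definition has_majorant (R : realType) d (T : measurableType d)
    (psi : R -> R) (gamma : R -> \bar R) n (mu : probability (n.-tuple T) R) :=
  forall dz (Z : measurableType dz) (A : set (n.-tuple T * Z)), measurable A ->
  exists K : n.-tuple T * Z -> \bar R,
    [/\ measurable_fun setT K,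
        forall x z, (expeR (Fpsi psi x (ysection A z)) <= K (x, z))%E &
        forall z, (\int[mu]_x K (x, z) <= expeR (gamma (fine (mu (ysection A z)))))%E].

(** There is a single empty tuple: F is an empty sum if it belongs to the section and +oo if not.
    The majorant is thus 1 or +oo, matched by gamma(1) >= 0 and gamma(0) = +oo. *)
Lemma has_majorant0 (R : realType) d (T : measurableType d) (psi : R -> R)
    (gamma : R -> \bar R) (mu : probability (0.-tuple T) R) :
  gamma 0 = +oo%E -> (0 <= gamma 1%R)%E -> has_majorant psi gamma mu.
Proof.
move=> gamma0 gamma1 dz Z A mA.
have all_nil (x : 0.-tuple T) : x = [tuple] by exact: tuple0.
exists (fun p => if p \in A then 1%E else +oo%E); split.
- apply: measurable_fun_ifT => //.
  apply: (measurable_fun_bool true) => /=.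
  rewrite setTI (_ : _ @^-1` _ = A)//.
  by apply/seteqP; split => p /=; [move/set_mem|move/mem_set].
- move=> x z; case: ifPn => [xzA|_]; last by rewrite leey.
  rewrite -expeR0 lee_expeR; apply: ereal_inf_lbound.
  exists (dirac x); last by rewrite big_ord0.
  by rewrite /prob_on /= diracE mem_ysection xzA.
- move=> z; have [xzA|xzA] := boolP (([tuple] : 0.-tuple T, z) \in A).
    have -> : ysection A z = setT.
      by apply/seteqP; split => // x _; rewrite /ysection /= (all_nil x).
    rewrite (probability_setT mu) /=.
    rewrite (eq_integral (cst 1%E)); last by move=> x _; rewrite (all_nil x) xzA.
    rewrite (integral_cst mu measurableT 1%E) /= (probability_setT mu) mule1.
    by rewrite -expeR0 lee_expeR.
  have -> : ysection A z = set0.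
    apply/seteqP; split => // x; rewrite /ysection /= (all_nil x).
    by rewrite (negbTE xzA).
  by rewrite measure0 gamma0 leey.
Qed.

(** Moves the first coordinate into the parameter, so that the induction hypothesis applies with
    parameter space [T * Z]. *)
Lemma measurable_cons_section d dz (T : measurableType d) (Z : measurableType dz)
    n (A : set (n.+1.-tuple T * Z)) : measurable A ->
  measurable [set p : n.-tuple T * (T * Z) | A ([tuple of p.2.1 :: p.1], p.2.2)].
Proof.
move=> mA; rewrite -[X in measurable X]setTI.
apply: (_ : measurable_fun setT (fun p : n.-tuple T * (T * Z) =>
  ([tuple of p.2.1 :: p.1] : n.+1.-tuple T, p.2.2))) => //.
apply: measurable_fun_pair; last exact: measurableT_comp.
by apply: measurable_cons => //; exact: measurableT_comp.
Qed.

(** * The induction step: building the majorant and bounding its integral *)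

Section majorant_cons.
Context (R : realType) d (T : measurableType d).
Context (psi : R -> R) (gamma : R -> \bar R).
Hypothesis psi_ge0 : forall r, 0 <= r <= 1 -> 0 <= psi r.
Hypothesis psi_convex : convex_function (`[0, 1] : set R^o) (psi : R^o -> R^o).
Hypothesis psi_incr : forall r s, 0 <= r -> r <= s -> s <= 1 -> psi r <= psi s.
Hypothesis psi0 : psi 0 = 0.
Hypothesis gamma_decr : forall r s, 0 <= r -> r <= s -> s <= 1 ->
  (gamma s <= gamma r)%E.
Hypothesis gamma0 : gamma 0 = +oo%E.
Hypothesis gamma_fin : forall r, 0 < r <= 1 -> gamma r \is a fin_num.
Hypothesis hyp_i : forall r0, 0 < r0 <= 1 ->
  concave_function `[0, r0]
    (fun r => expR (G1 psi (gamma r - gamma r0)%E)).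

Context n (Q : probability T R) (mu : probability (n.-tuple T) R).
Context dz (Z : measurableType dz) (A : set (n.+1.-tuple T * Z)).
Hypothesis mA : measurable A.

Let A' : set (n.-tuple T * (T * Z)) :=
  [set p : n.-tuple T * (T * Z) | A ([tuple of p.2.1 :: p.1], p.2.2)].

Let mA' : measurable A' := measurable_cons_section mA.

Context (K : n.-tuple T * (T * Z) -> \bar R).
Hypothesis mK : measurable_fun setT K.
Hypothesis KF : forall y uz, (expeR (Fpsi psi y (ysection A' uz)) <= K (y, uz))%E.
Hypothesis IK : forall uz,
  (\int[mu]_y K (y, uz) <= expeR (gamma (fine (mu (ysection A' uz)))))%E.

Let r uz := fine (mu (ysection A' uz)).

Let mr : measurable_fun setT r.
Proof.
apply: measurableT_comp => //.
exact: (measurable_fun_ysection mu mA').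
Qed.

Let r01 uz : 0 <= r uz <= 1.
Proof.
have mS : measurable (ysection A' uz) by exact: measurable_ysection.
by rewrite fine_ge0//= -lee_fin fineK ?fin_num_measure// probability_le1.
Qed.

Let K_ge0 p : (0 <= K p)%E.
Proof. by case: p => y uz; apply: le_trans (KF _ _); exact: expeR_ge0. Qed.

Let good s : set (T * Z) := [set uz | s <= r uz].

Let mgood s : measurable (good s).
Proof. by rewrite /good -[X in measurable X]setTI -preimage_itvcy; exact: mr. Qed.

Let kappa s z := Q (ysection (good s) z).

Let mkappa s : measurable_fun setT (kappa s).
Proof. exact: (measurable_fun_ysection Q (mgood s)). Qed.

Let W s y z := (\int[Q]_(u in ysection (good s) z) K (y, (u, z)))%E.

(** The indicator makes [W] an integral over the whole of [T], whose joint measurability in (y, z)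
    comes from Tonelli. *)
Let Wind (s : R) (q : n.-tuple T * Z * T) : \bar R :=
  (K (q.1.1, (q.2, q.1.2)) * (\1_(good s) (q.2, q.1.2))%:E)%E.

Let mWind s : measurable_fun setT (Wind s).
Proof.
have mq : measurable_fun setT
    (fun q : n.-tuple T * Z * T => (q.2, q.1.2)).
  by apply: measurable_fun_pair => //; exact: measurableT_comp.
apply: emeasurable_funM.
  apply: measurableT_comp => //; apply: measurable_fun_pair => //.
  exact: measurableT_comp.
apply/measurable_EFinP; apply: measurableT_comp => //; exact: measurable_indic.
Qed.

Let Wind_ge0 s q : (0 <= Wind s q)%E.
Proof. by rewrite mule_ge0// lee_fin. Qed.

Let WE s y z : W s y z = (\int[Q]_u Wind s (y, z, u))%E.
Proof.
rewrite /W integral_mkcond epatch_indic; apply: eq_integral => u _ /=.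
by rewrite /Wind /= !indicE mem_ysection.
Qed.

Let mW s : measurable_fun setT (fun q : n.-tuple T * Z => W s q.1 q.2).
Proof.
rewrite (_ : (fun _ => _) = (fun q => \int[Q]_u Wind s (q, u))%E).
  exact: (@measurable_fun_fubini_tonelli_F _ _ _ _ _ Q (Wind s)).
by apply/funext => -[y z]; rewrite WE.
Qed.

Let W_ge0 s y z : (0 <= W s y z)%E.
Proof. exact: integral_ge0. Qed.

(* For an admissible [(a, b, b', s)], [cand] dominates [expeR (Fpsi _ _)]: spread
   the coefficient [b'] over the sections of probability at least [s]. Rational
   coefficients suffice, which keeps the infimum [Kcons] measurable. *)
Let admissible (i : rat * rat * rat * rat) (z : Z) : bool :=
  let: (a, b, b', s) := i in
  [&& (0 <= ratr a :> R), (0 <= ratr b :> R), (0 <= ratr b' :> R),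
      `[< dominated psi (ratr a) (ratr b') >] &
      ((ratr b')%:E <= (ratr b)%:E * kappa (ratr s) z)%E].

Let cand (i : rat * rat * rat * rat) (p : n.-tuple T * (T * Z)) : \bar R :=
  if admissible i p.2.2 then
    let: (a, b, b', s) := i in
    ((ratr a)%:E * K p + (ratr b)%:E * W (ratr s) p.1 p.2.2)%E
  else +oo%E.

Let mcand i : measurable_fun setT (cand i).
Proof.
case: i => [[[a b] b'] s]; apply: measurable_fun_ifT => //.
  rewrite /admissible; do 4 apply: measurable_and => //.
  apply: (measurable_fun_bool true) => /=.
  rewrite setTI (_ : _ @^-1` _ = [set p : n.-tuple T * (T * Z) |
    ((ratr b')%:E <= (ratr b)%:E * kappa (ratr s) p.2.2)%E])//.
  rewrite -[X in measurable X]setTI; apply: emeasurable_fun_c_infty => //.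
  by apply: measurable_funeM; do 2 apply: measurableT_comp => //.
apply: emeasurable_funD; apply: measurable_funeM => //.
apply: (measurableT_comp (mW (ratr s)) (_ : measurable_fun setT
  (fun p : n.-tuple T * (T * Z) => (p.1, p.2.2)))).
by apply: measurable_fun_pair => //; exact: measurableT_comp.
Qed.

(** The quadruples are enumerated by [unpickle], so that measurability is that of [einfs]; a number
    coding no quadruple contributes the neutral value +oo. *)
Let Kcons (p : n.+1.-tuple T * Z) : \bar R :=
  einfs (fun k => if unpickle k is Some i
    then cand i ([tuple of behead p.1], (thead p.1, p.2)) else +oo%E) 0.

Let mKcons : measurable_fun setT Kcons.
Proof.
apply: measurable_fun_einfs => k; case: unpickle => [i|]//.
apply: (measurableT_comp (mcand i)); apply: measurable_fun_pair.
  exact: (measurableT_comp (@measurable_behead _ T n) measurable_fst).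
apply: measurable_fun_pair => //.
exact: (measurableT_comp (@measurable_tnth _ T n.+1 ord0) measurable_fst).
Qed.

Let Kcons_le i u (y : n.-tuple T) z :
  (Kcons ([tuple of u :: y], z) <= cand i (y, (u, z)))%E.
Proof.
rewrite /Kcons einfs0; apply: ereal_inf_lbound; exists (pickle i) => //.
by rewrite pickleK /=; congr (cand i (_, (_, _))); exact/val_inj.
Qed.

(** For an admissible quadruple, [Fpsi_cons] and domination give a bound for every [m]; [le_average]
    turns it into the candidate. *)
Let Kcons_ge x z : (expeR (Fpsi psi x (ysection A z)) <= Kcons (x, z))%E.
Proof.
rewrite /Kcons einfs0; apply: le_ereal_inf_tmp => _ [k _ <-].
case: unpickle => [[[[a b] b'] s]|]; last by rewrite leey.
rewrite /cand; case: ifP; last by rewrite leey.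
move=> /and5P[a0 b0 b'0 /asboolP[t t01 dom] bb'].
set u := thead x; set y : n.-tuple T := [tuple of behead x].
have xE : x = [tuple of u :: y] by exact: tuple_eta.
apply: (@le_average _ _ _ Q _ (fun m => K (y, (m, z))) _ _ _ (ratr b') u) => //.
- exact: measurable_ysection.
- by apply: (measurableT_comp mK); exact: measurable_fun_pair.
- exact: expeR_ge0.
- by rewrite mule_ge0.
move=> m.
have mAz : measurable (ysection A z) by exact: measurable_ysection.
have secE v : section (ysection A z) v = ysection A' (v, z).
  by apply/seteqP; split => w; rewrite /section /ysection /= !inE.
have := Fpsi_cons psi_ge0 psi_convex psi_incr u m y mAz t01.
rewrite -xE -lee_expeR => /le_trans; apply.
apply: le_trans (dom _ _ _ _) _; [exact: Fpsi_ge0|exact: Fpsi_ge0|].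
by rewrite !secE; apply: leeD; apply: lee_wpmul2l; rewrite ?lee_fin.
Qed.

Context (nu : probability (n.+1.-tuple T) R).
Hypothesis nuE : forall f : n.+1.-tuple T -> \bar R,
  measurable_fun setT f -> (forall x, 0 <= f x)%E ->
  (\int[nu]_x f x = \int[Q]_u \int[mu]_y f [tuple of u :: y])%E.

Let Kcons_ge0 p : (0 <= Kcons p)%E.
Proof. by case: p => x z; apply: le_trans (Kcons_ge _ _); exact: expeR_ge0. Qed.

Let mKy uz : measurable_fun setT (fun y => K (y, uz)).
Proof. by apply: (measurableT_comp mK); exact: measurable_fun_pair. Qed.

Let mWy s z : measurable_fun setT (fun y => W s y z).
Proof.
apply: (measurableT_comp (mW s) (_ : measurable_fun setT (fun y => (y, z)))).
exact: measurable_fun_pair.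
Qed.

(** After exchanging the integrals, each section of probability at least [s] contributes at most
    exp(gamma(s)), because [gamma] decreases. *)
Let IW s z : 0 < s <= 1 ->
  (\int[mu]_y W s y z <= kappa s z * expeR (gamma s))%E.
Proof.
move=> s01; have mD : measurable (ysection (good s) z) by exact: measurable_ysection.
under eq_integral do rewrite WE.
have mf : measurable_fun setT (fun q : n.-tuple T * T => Wind s (q.1, z, q.2)).
  apply: (measurableT_comp (mWind s)); apply: measurable_fun_pair => //.
  exact: measurable_fun_pair.
rewrite (@fubini_tonelli _ _ _ _ _ mu Q (fun q => Wind s (q.1, z, q.2)))//=.
rewrite muleC -(integral_cst Q mD) [leRHS]integral_mkcond.
apply: ge0_le_integral => //.
- by move=> u _; exact: integral_ge0.
- apply: (@measurable_fun_fubini_tonelli_G _ _ _ _ _ mu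
    (fun q => Wind s (q.1, z, q.2))) => //.
- by apply/(measurable_restrictT _ mD).1.
move=> u _; rewrite patchE; case: ifPn => [|uN]; last first.
  rewrite integral0_eq// => y _; rewrite /Wind /= indicE.
  by move: uN; rewrite mem_ysection => /negbTE ->; rewrite mule0.
move=> /set_mem; rewrite /ysection /= => /set_mem gu.
rewrite (eq_integral (fun y => K (y, (u, z)))); last first.
  by move=> y _; rewrite /Wind /= indicE mem_set// mule1.
apply: (le_trans (IK (u, z))); rewrite lee_expeR.
by apply: gamma_decr => //; [lra|have /andP[] := r01 (u, z)].
Qed.

Let J z u := (\int[mu]_y Kcons ([tuple of u :: y], z))%E.

Let mKcons_uy z : measurable_fun setT
  (fun p : T * n.-tuple T => Kcons ([tuple of p.1 :: p.2], z)).
Proof.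
apply: (measurableT_comp mKcons); apply: measurable_fun_pair => //.
exact: measurable_cons.
Qed.

Let J_le z u a b b' s :
  admissible (a, b, b', s) z -> 0 < (ratr s : R) <= 1 ->
  (J z u <= (ratr a)%:E * expeR (gamma (r (u, z)))
            + (ratr b)%:E * (kappa (ratr s) z * expeR (gamma (ratr s))))%E.
Proof.
move=> adm s01.
have /and5P[a0 b0 _ _ _] := adm.
apply: (@le_trans _ _ (\int[mu]_y ((ratr a)%:E * K (y, (u, z)) +
    (ratr b)%:E * W (ratr s) y z))%E).
  apply: ge0_le_integral => //.
  - by apply: (measurableT_comp (mKcons_uy z) (_ : measurable_fun setT (pair u))).
  - by apply: emeasurable_funD; exact: measurable_funeM.
  - by move=> y _; apply: (le_trans (Kcons_le (a, b, b', s) u y z)); rewrite /cand ifT.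
rewrite ge0_integralD//; last 4 first.
- by move=> y _; rewrite mule_ge0.
- exact: measurable_funeM.
- by move=> y _; rewrite mule_ge0.
- exact: measurable_funeM.
rewrite !ge0_integralZl//.
apply: leeD; (apply: lee_wpmul2l; first by rewrite lee_fin); [exact: IK|exact: IW].
Qed.

Let J_le_section z u : (J z u <= expeR (gamma (r (u, z))))%E.
Proof.
(* No mixing: t = 1, with psi(0) = 0. *)
have adm : admissible (1%Q, 0%Q, 0%Q, 1%Q) z.
  rewrite /admissible rmorph1 rmorph0 lexx ler01 mul0e lexx andbT /=.
  apply/asboolP; exists 1; first by rewrite ler01 lexx.
  by move=> h k h0 k0; rewrite subrr psi0 add0e mul1e !mul0e !adde0 mul1e.
have := J_le u adm; rewrite rmorph0 rmorph1 mul0e adde0 mul1e; apply.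
by rewrite ltr01 lexx.
Qed.

(** The tangent coefficients at (c1, c2) turn the linear bound into the desired exponential; they
    are approximated from above by rationals, [b] being close to b' / k since b' is spread over a
    set of measure [k]. *)
Let J_le_mixture z u (q : rat) c :
  0 < (ratr q : R) <= 1 -> (0 < Q [set m | (ratr q <= r (m, z))%R])%E ->
  0 <= c <= 1 -> (r (u, z) = 0 -> c = 0) ->
  (J z u <= (expR (psi (1 - c) + c * fine (gamma (r (u, z)))
                   + (1 - c) * fine (gamma (ratr q))))%:E)%E.
Proof.
move=> q01 Qq c01 rc.
set c1 := fine (gamma (r (u, z))); set c2 := fine (gamma (ratr q)).
have kappaE : kappa (ratr q) z = Q [set m | (ratr q <= r (m, z))%R].
  by congr (Q _); apply/seteqP; split => m; rewrite /ysection /= ?inE.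
have kf : kappa (ratr q) z \is a fin_num.
  by apply: fin_num_measure; exact: measurable_ysection.
pose k := fine (kappa (ratr q) z).
have k0 : 0 < k by rewrite -lte_fin fineK// kappaE.
have k1 : k <= 1.
  by rewrite -lee_fin fineK//; apply: probability_le1; exact: measurable_ysection.
have [a0 [b0 [a00 b00 ca abE dom]]] := dominated_tangent psi c1 c2 c01.
rewrite -abE; apply/lee_addgt0Pr => e e0.
have e1 := expR_gt0 c1; have e2 := expR_gt0 c2.
(* The coefficient [a] exceeds [a0] by at most [dl]; b * k exceeds [b0] by at most 2 * dl, one [dl]
   for each of b' and [b]. *)
pose dl := e / (expR c1 + 2 * expR c2).
have dl0 : 0 < dl by rewrite divr_gt0// addr_gt0// mulr_gt0.
(* When r (u, z) = 0 the factor of [a] is +oo, so [a] must vanish exactly. *)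
have [a [aa0 adl ra]] : exists a : rat, [/\ a0 <= ratr a, ratr a <= a0 + dl &
    r (u, z) = 0 -> a = 0%Q].
  have [c_eq0|cN0] := eqVneq c 0.
    by exists 0%Q; rewrite rmorph0 ca//; split => //; lra.
  have : a0 < a0 + dl by rewrite ltrDl.
  move=> /rat_in_itvoo[a]; rewrite in_itv /= => /andP[h1 h2].
  exists a; split; [exact: ltW|exact: ltW|].
  by move=> /rc c_eq0; rewrite c_eq0 eqxx in cN0.
have : b0 < b0 + dl by rewrite ltrDl.
move=> /rat_in_itvoo[b']; rewrite in_itv /= => /andP[bb' b'dl].
have : ratr b' / k < ratr b' / k + dl by rewrite ltrDl.
move=> /rat_in_itvoo[b]; rewrite in_itv /= => /andP[b'b bdl].
have b'0 : 0 <= (ratr b' : R) by lra.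
have b_ge0 : 0 <= (ratr b : R).
  by rewrite (le_trans _ (ltW b'b))// divr_ge0// ltW.
have adm : admissible (a, b, b', q) z.
  rewrite /admissible b_ge0 b'0 (le_trans a00 aa0) /=; apply/andP; split.
    by apply/asboolP; apply: dom => //; exact: ltW.
  by rewrite -(fineK kf) -EFinM lee_fin -ler_pdivrMr// ltW.
apply: (le_trans (J_le u adm q01)).
have g2 : gamma (ratr q) = c2%:E by rewrite fineK// gamma_fin.
rewrite g2 -(fineK kf) -/k.
have -> : ((ratr a)%:E * expeR (gamma (r (u, z))) = (ratr a * expR c1)%:E)%E.
  have [r0|rN0] := eqVneq (r (u, z)) 0.
    by rewrite (ra r0) rmorph0 mul0e mul0r.
  have rp : 0 < r (u, z) <= 1.
    by have := r01 (u, z); rewrite lt_def rN0 => /andP[-> ->].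
  by rewrite -[gamma _](fineK (gamma_fin rp)) -/c1 /= -EFinM.
rewrite /= -!EFinM -!EFinD lee_fin.
have h1 : ratr b * k <= ratr b' + dl.
  rewrite -ler_pdivlMr// mulrDl (le_trans (ltW bdl))// lerD2l.
  by rewrite ler_pdivlMr// ler_piMr// ltW.
have h2 : ratr a * expR c1 <= (a0 + dl) * expR c1 by rewrite ler_wpM2r// ltW.
have h3 : ratr b * (k * expR c2) <= (b0 + 2 * dl) * expR c2.
  by rewrite mulrA ler_wpM2r ?(ltW e2)//; lra.
apply: (le_trans (lerD h2 h3)).
have -> : e = dl * (expR c1 + 2 * expR c2).
  by rewrite divfK// gt_eqF// addr_gt0// mulr_gt0.
by rewrite le_eqVlt; apply/orP; left; apply/eqP; ring.
Qed.

Lemma majorant_cons : exists K' : n.+1.-tuple T * Z -> \bar R,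
  [/\ measurable_fun setT K',
      forall x z, (expeR (Fpsi psi x (ysection A z)) <= K' (x, z))%E &
      forall z, (\int[nu]_x K' (x, z) <=
                 expeR (gamma (fine (nu (ysection A z)))))%E].
Proof.
exists Kcons; split => // z.
have mAz : measurable (ysection A z) by exact: measurable_ysection.
have secE v : section (ysection A z) v = ysection A' (v, z).
  by apply/seteqP; split => w; rewrite /section /ysection /= !inE.
rewrite nuE//; last exact: (measurableT_comp mKcons (measurable_fun_pair _ _)).
apply: (integral_sections_le psi_ge0 psi0 gamma_decr gamma0 gamma_fin hyp_i
  (r := fun u => r (u, z))) => //.
- by apply: (measurableT_comp mr); exact: measurable_fun_pair.
- apply: (@measurable_fun_fubini_tonelli_F _ _ _ _ _ mu
    (fun p => Kcons ([tuple of p.1 :: p.2], z))) => //.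
- by move=> u; exact: integral_ge0.
- by move=> u; exact: J_le_section.
- by move=> u q q01 Qq c c01 rc; exact: J_le_mixture.
rewrite fineK ?fin_num_measure// (product_rule_section nuE mAz).
apply: eq_integral => u _; rewrite secE fineK// fin_num_measure//.
exact: measurable_ysection.
Qed.

End majorant_cons.

(* No measurability is required: the integral of a nonnegative function is a
   supremum over the simple functions below it. *)
Lemma le_integralT (R : realType) d (T : measurableType d)
    (mu : {measure set T -> \bar R}) (f g : T -> \bar R) :
  (forall x, 0 <= f x)%E -> (forall x, f x <= g x)%E ->
  (\int[mu]_x f x <= \int[mu]_x g x)%E.
Proof.
move=> f0 fg; rewrite !ge0_integralTE//; last first.
  by move=> x; exact: le_trans (fg x).
apply: le_ereal_sup => _ [h hf <-]; exists h => // x.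
exact: le_trans (fg x).
Qed.

(** * Induction on the dimension and transfer to the sample space *)

Unset Implicit Arguments.

Theorem theorem1 (R : realType) (d : measure_display) (T : measurableType d)
    (psi : R -> R) (gamma : R -> \bar R)
    (psi_ge0 : forall r, 0 <= r <= 1 -> 0 <= psi r)
    (psi_convex : convex_function (`[0, 1] : set R^o) (psi : R^o -> R^o))
    (psi_incr : forall r s, 0 <= r -> r <= s -> s <= 1 -> psi r <= psi s)
    (psi0 : psi 0 = 0)
    (dpsi0 : (psi h - psi 0) / h @[h --> 0^'+] --> 0)
    (gamma_decr : forall r s, 0 <= r -> r <= s -> s <= 1 ->
      (gamma s <= gamma r)%E)
    (gamma0 : gamma 0 = +oo%E)
    (gamma_fin : forall r, 0 < r <= 1 -> gamma r \is a fin_num)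
    (hyp_i : forall r0, 0 < r0 <= 1 ->
      concave_function `[0, r0]
        (fun r => expR (G1 psi (gamma r - gamma r0)%E)))
    (hyp_ii : forall p, 0 <= p <= 1 ->
      (((1 - p) * expR (psi 1) + p)%:E <= expeR (gamma p))%E)
    (n : nat) (n_ge1 : (1 <= n)%N)
    (A : set (n.-tuple T)) (mA : measurable A)
    (d' : measure_display) (Omega : measurableType d')
    (P : probability Omega R) (X : {RV P >-> n.-tuple T})
    (X_indep : independent_components P X) :
  (\int[P]_w expeR (Fpsi psi (X w) A)
     <= expeR (gamma (fine (P [set w | A (X w)]))))%E.
Proof.
(* Condition (ii) at p = 1, for the base case. *)
have gamma1 : (0 <= gamma 1%R)%E.
  rewrite -lee_expeR expeR0; have := hyp_ii 1.
  by rewrite ler01 lexx subrr mul0r add0r; exact.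
have maj : forall k (mu : probability (k.-tuple T) R),
    product_rule mu -> has_majorant psi gamma mu.
  elim=> [|k IH] mu pr; first exact: has_majorant0.
  have [Q [mu' [pr' muE]]] := product_rule_cons pr.
  move=> dz Z B mB.
  have [K [mK KF IK]] := IH mu' pr' _ _ _ (measurable_cons_section mB).
  exact: (majorant_cons psi_ge0 psi_convex psi_incr psi0 gamma_decr gamma0
    gamma_fin hyp_i mB mK KF IK muE).
pose mu : probability (n.-tuple T) R := distribution P X.
have pr : product_rule mu.
  move=> B mB; have := X_indep [set: 'I_n]%SET B (fun i _ => mB i).
  rewrite (_ : \bigcap_(i in _) _ = X @^-1` [set x | forall i, B i (tnth x i)]).
    by under eq_bigl do rewrite finset.in_setT.
  apply/seteqP; split => w /= h i; last by move=> _; exact: h.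
  by apply: h; rewrite /= finset.in_setT.
(* A one-point parameter space recovers the statement without parameter. *)
have mAT : measurable (A `*` [set: unit]) by exact: measurableX.
have [K [mK KF IK]] := maj n mu pr _ _ _ mAT.
have secA : ysection (A `*` [set: unit]) tt = A.
  by apply/seteqP; split => x; rewrite /ysection /= inE => // -[].
have := IK tt; rewrite secA => /(le_trans _); apply.
rewrite ge0_integral_distribution//; last 2 first.
- by apply: (measurableT_comp mK); exact: measurable_fun_pair.
- by move=> x; apply: le_trans (KF x tt); exact: expeR_ge0.
apply: le_integralT => w; first exact: expeR_ge0.
by have := KF (X w) tt; rewrite secA.
Qed.
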